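(* Let $n\geq 3$ and let $\{\pi_i\}_{i=1}^{n-1}$ be a family of non-zero polynomial divided difference operators, $\pi_i$ having index $i$, that satisfy the cubic braid relations $\pi_i\pi_{i+1}\pi_i=\pi_{i+1}\pi_i\pi_{i+1}$ for $1\leq i\leq n-2$. If the polynomial $T$ associated with one of these operators vanishes then it vanishes for all of them. In this case, for each $i$ there is a two-variable polynomial $R_i$ such that $\pi_i f=R_i(x_i,x_{i+1})\cdot s_i f$ for every $f$, and $R_i$ and $R_{i+1}$ are almost equal (as polynomials in the same pair of variables) for every $1\leq i\leq n-2$.
   Context: $K$ is a field of arbitrary characteristic over which all polynomials are defined; possible extra parameters are regarded as elements of $K$. The operators act on functions $f$ of variables $x_1,\dots,x_n$ (concretely $f\in K[x_1,\dots,x_n]$). The operator $s_i$ interchanges $x_i$ and $x_{i+1}$, and $\partial_i f=\frac{f-s_i f}{x_i-x_{i+1}}$. A polynomial divided difference operator with index $i$ is an operator of the form $$\pi_i f=\partial_i\big(P(x_i,x_{i+1})f\big)+Q(x_i,x_{i+1})\partial_i f+R(x_i,x_{i+1})f+S(x_i,x_{i+1})s_i f,$$ with two-variable polynomials $P,Q,R,S$ that may differ for different $i$. Its associated polynomial $T(u,v)=P(u,v)+(u-v)R(u,v)+Q(u,v)$ depends only on the operator, not on the presentation. Two non-zero polynomials $A$ and $\widetilde A$ in two variables $u,v$ are almost equal if there exist a polynomial $\widehat A$ in two variables and univariate polynomials $q_l,q_r,\widetilde q_l,\widetilde q_r$ satisfying the product property $q_l q_r=\widetilde q_l\widetilde q_r$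 (an equality of univariate polynomials) such that $A(u,v)=q_l(u)q_r(v)\widehat A(u,v)$ and $\widetilde A(u,v)=\widetilde q_l(u)\widetilde q_r(v)\widehat A(u,v)$. *)

(* Defs.v *)
From HB Require Import structures.
From mathcomp Require Import all_boot all_order all_algebra all_fingroup.
From mathcomp Require Import mpoly.

Set Implicit Arguments.
Unset Strict Implicit.
Unset Printing Implicit Defensive.

Import GRing.Theory.

Local Open Scope ring_scope.

(* Operator indices 1 <= i <= n - 1 are shifted to i : 'I_n.-1; vl i and vr i
   are the indices in 'I_n of the variables x_i and x_{i+1}. *)
Definition vl (n : nat) (i : 'I_n.-1) : 'I_n := widen_ord (leq_pred n) i.

Lemma vr_subproof (n : nat) (i : 'I_n.-1) : (i.+1 < n)%N.
Proof. by rewrite -ltn_predRL. Qed.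

Definition vr (n : nat) (i : 'I_n.-1) : 'I_n := Ordinal (vr_subproof i).

Section Operators.
Context (K : fieldType) (n : nat).
Implicit Types (i : 'I_n.-1) (f g : {mpoly K[n]}) (A : {mpoly K[2]}).

Definition sw i f : {mpoly K[n]} := msym (tperm (vl i) (vr i)) f.

(* A(x_i, x_{i+1}) *)
Definition at2 i A : {mpoly K[n]} := A \mPo [tuple 'X_(vl i); 'X_(vr i)].

Lemma vl_neq_vr i : vl i != vr i.
Proof. by rewrite -val_eqE /= neq_ltn ltnSn. Qed.

Lemma ddiff_denom_neq0 i : 'X_(vl i) - 'X_(vr i) != 0 :> {mpoly K[n]}.
Proof.
rewrite subr_eq0; apply/eqP => /(congr1 (mcoeff U_(vl i))) /eqP.
rewrite !mcoeffXU eqxx [vr i == _]eq_sym (negPf (vl_neq_vr i)).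
by rewrite oner_eq0.
Qed.

Lemma ddiff_exists i f :
  exists g, ('X_(vl i) - 'X_(vr i)) * g == f - sw i f.
Proof.
set D := _ - _; pose dv f := exists g, D * g == f - sw i f.
have dvM f1 f2 : dv f1 -> dv f2 -> dv (f1 * f2).
  move=> [g1 /eqP e1] [g2 /eqP e2]; exists (f1 * g2 + g1 * sw i f2); apply/eqP.
  by rewrite mulrDr mulrCA e2 mulrA e1 /sw rmorphM /= mulrBr mulrBl addrA subrK.
have dv1 : dv 1 by exists 0; rewrite /sw rmorph1 subrr mulr0.
have dvX k : dv 'X_k.
  have sX : sw i 'X_k = 'X_(tperm (vl i) (vr i) k).
    by rewrite /sw /msym mmapX mmap1U.
  rewrite /dv sX; case: tpermP => [->|->|_ _].
  - by exists 1; rewrite mulr1.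
  - by exists (- 1); rewrite mulrN1 opprB.
  - by exists 0; rewrite subrr mulr0.
rewrite -/(dv f); elim/mpolyind: f => [|c m p _ _ [g /eqP eg]].
  by exists 0; rewrite /sw raddf0 subrr mulr0.
have [h /eqP eh] : dv 'X_[m].
  rewrite mpolyXE_id; apply: (big_ind dv) => // k _.
  by elim: (m k) => [|l IH]; rewrite ?expr0 // exprS; apply: dvM.
exists (c *: h + g); apply/eqP.
by rewrite mulrDr -scalerAr eh eg /sw msymD msymZ scalerBr opprD addrACA.
Qed.

(* The divided difference (f - s_i f) / (x_i - x_{i+1}): the division is exact
   and, {mpoly K[n]} being an integral domain, its quotient is unique. *)
Definition ddiff i f : {mpoly K[n]} := xchoose (ddiff_exists i f).

Lemma ddiffP i f : ('X_(vl i) - 'X_(vr i)) * ddiff i f = f - sw i f.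
Proof. exact/eqP/(xchooseP (ddiff_exists i f)). Qed.

Lemma ddiff_uniq i f g :
  ('X_(vl i) - 'X_(vr i)) * g = f - sw i f -> g = ddiff i f.
Proof. by rewrite -ddiffP; apply: mulfI; apply: ddiff_denom_neq0. Qed.

Definition pddo (P Q R S : {mpoly K[2]}) i f : {mpoly K[n]} :=
  ddiff i (at2 i P * f) + at2 i Q * ddiff i f + at2 i R * f + at2 i S * sw i f.

End Operators.

Section TwoVariables.
Context (K : fieldType).

Definition uvar : {mpoly K[2]} := 'X_ord0.
Definition vvar : {mpoly K[2]} := 'X_ord_max.

Definition assoc_poly (P Q R : {mpoly K[2]}) : {mpoly K[2]} :=
  P + (uvar - vvar) * R + Q.

Definition almost_equal (A A' : {mpoly K[2]}) : Prop :=
  [/\ A != 0, A' != 0 &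
    exists (B : {mpoly K[2]}) (ql qr ql' qr' : {poly K}),
      [/\ ql * qr = ql' * qr',
          A = horner_alg uvar ql * horner_alg vvar qr * B &
          A' = horner_alg uvar ql' * horner_alg vvar qr' * B]].

End TwoVariables.

(* Main.v *)
From HB Require Import structures.
Require Import Defs.
From mathcomp Require Import all_boot all_order all_algebra all_fingroup.
From mathcomp Require Import mpoly.
From mathcomp Require Import ring.

Import GRing.Theory.

Local Open Scope ring_scope.

(* Expand each operator over the functions w . f with w in the symmetric group;
   the coefficients are unique by independence of characters.  If T_i = 0 then
   pi_i is r s_i, and comparing the coefficients of the identity in the braid
   relation with a neighbour pi_j forces T_j = 0.  Once all T_i vanish, the braid
   relation between A(x,y) s_1 and B(y,z) s_2 reads
     A(x,y) B(x,z) A(y,z) = B(y,z) A(x,z) B(x,y),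
   and the leading coefficients a, b of A and B in their second variable give
     A(x,y) b(x) a(y) = B(x,y) a(x) b(y).
   Dividing a and b by their gcd, one gets A = a(x) b(y) C and B = b(x) a(y) C. *)

Lemma mpoly_rmorph_ext (R S : comNzRingType) (n : nat)
    (f g : {rmorphism {mpoly R[n]} -> S}) :
  (forall c, f c%:MP = g c%:MP) -> (forall k, f 'X_k = g 'X_k) -> f =1 g.
Proof.
move=> fgC fgX p; elim/mpolyind: p => [|c m p _ _ IHp]; first by rewrite !rmorph0.
rewrite !rmorphD /= IHp -mul_mpolyC !rmorphM /= fgC; congr (_ * _ + _).
rewrite mpolyXE_id !rmorph_prod; apply: eq_bigr => k _.
by rewrite !rmorphXn /= fgX.
Qed.

Lemma msymX1 (R : comNzRingType) (n : nat) (s : 'S_n) (k : 'I_n) :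
  msym s 'X_k = 'X_(s k) :> {mpoly R[n]}.
Proof. by rewrite /msym mmapX mmap1U. Qed.

Lemma mpolyX_inj (R : comNzRingType) (n : nat) (k l : 'I_n) :
  'X_k = 'X_l :> {mpoly R[n]} -> k = l.
Proof.
move=> /(congr1 (mcoeff U_(k))) /eqP; rewrite !mcoeffXU eqxx.
by case: (l =P k) => // _; rewrite oner_eq0.
Qed.

(* The case of Dedekind's independence of characters that is needed below: the
   terms of [r] are removed one by one, substituting [x_k f] for [f]. *)
Lemma msym_id_coeff_eq0 (R : idomainType) (n : nat) (c : {mpoly R[n]})
    (r : seq ('S_n * {mpoly R[n]})) :
  all (fun e => e.1 != 1%g) r ->
  (forall f, c * f + \sum_(e <- r) e.2 * msym e.1 f = 0) -> c = 0.
Proof.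
have [m] := ubnP (size r); elim: m r c => // m IHm [|[s e] r] c /=.
  by move=> _ _ /(_ 1); rewrite big_nil addr0 mulr1.
rewrite ltnS => r_lt /andP[s_neq1 r_neq1] c0.
have [k sk] : exists k, s k != k.
  apply/existsP; apply: contraR s_neq1 => /existsPn sid.
  by apply/eqP/permP => k; rewrite perm1; apply/eqP; rewrite -[_ == _]negbK sid.
suff /eqP : c * ('X_k - 'X_(s k)) = 0.
  rewrite mulf_eq0 => /orP[/eqP//|]; rewrite subr_eq0 => /eqP/mpolyX_inj kE.
  by rewrite -kE eqxx in sk.
pose twist (e' : 'S_n * {mpoly R[n]}) := (e'.1, e'.2 * ('X_(e'.1 k) - 'X_(s k))).
apply: (IHm (map twist r)); first by rewrite size_map.
  by rewrite all_map; apply: sub_all r_neq1.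
move=> f; have := c0 ('X_k * f); have := c0 f.
rewrite !big_cons big_map /= !msymM !msymX1.
under [X in _ -> _ -> _ + X = 0]eq_bigr do rewrite mulrBr mulrBl.
under [X in _ -> _ + (_ + X) = 0 -> _]eq_bigr do rewrite msymM msymX1 mulrA.
rewrite sumrB.
set X1 := \sum_(i <- r) _; set X2 := \sum_(i <- r) _.
have -> : \sum_(i <- r) i.2 * 'X_(s k) * msym i.1 f = 'X_(s k) * X1.
  by rewrite mulr_sumr; apply: eq_bigr => i _; rewrite mulrCA mulrA.
move=> /(congr1 ( *%R 'X_(s k))) e1 e2; rewrite mulr0 in e1.
by rewrite -[RHS](subrr 0) -{1}e2 -e1; ring.
Qed.

Lemma braid_coeff_eq0 (R : idomainType) (n : nat) (s t : 'S_n)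
    (p q : {mpoly R[n]} -> {mpoly R[n]}) (r d U V : {mpoly R[n]}) :
  (s * s = 1)%g -> (t * t = 1)%g -> s != 1%g -> t != 1%g -> s != t ->
  (forall f, p f = r * msym s f) ->
  (forall f, d * q f = U * f + V * msym t f) ->
  r != 0 -> d != 0 ->
  (forall f, p (q (p f)) = q (p (q f))) -> U = 0.
Proof.
move=> ss tt s1 t1 st pE qE r0 d0 pqp.
have ssK (f : {mpoly R[n]}) : msym s (msym s f) = f by rewrite -msymMm ss msym1m.
have msym_eq0 (w : 'S_n) (g : {mpoly R[n]}) : (msym w g == 0) = (g == 0).
  by rewrite -[RHS](inj_eq (@inj_msym _ _ w)) msym0.
pose sd := msym s d; pose tsd := msym t sd.
have sdE f : sd * msym s (q f) = msym s U * msym s f + msym s V * msym s (msym t f).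
  by rewrite -!msymM -msymD -qE.
have tsdE f : tsd * msym t (msym s (q f)) =
    msym t (msym s U) * msym t (msym s f) +
    msym t (msym s V) * msym t (msym s (msym t f)).
  by have := congr1 (msym t) (sdE f); rewrite msymD !msymM.
suff /eqP : d * tsd * r * msym s U * msym s r = 0.
  by rewrite /tsd /sd !mulf_eq0 !msym_eq0 (negPf d0) (negPf r0) /= orbF => /eqP.
apply: (@msym_id_coeff_eq0 _ _ _
  [:: ((s * t * s)%g, d * tsd * r * msym s V * msym s (msym t r));
      (s, - (tsd * U * r * msym s U));
      ((t * s)%g, - (tsd * U * r * msym s V));
      ((s * t)%g, - (sd * V * msym t r * msym t (msym s U)));
      ((t * s * t)%g, - (sd * V * msym t r * msym t (msym s V)))]) => [|f].
  have neq1 (v w x : 'S_n) : (v * v = 1 -> x != 1 -> v * x * v != 1)%g.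
    move=> vv; apply: contraNneq => e; have -> : x = (v * (v * x * v) * v)%g.
      by rewrite !mulgA vv mul1g -mulgA vv mulg1.
    by rewrite e mulg1 vv.
  have neq2 (v w : 'S_n) : (v * v = 1 -> w != v -> v * w != 1)%g.
    by move=> vv; apply: contraNneq => e; rewrite -[w]mul1g -vv -mulgA e mulg1.
  by rewrite /= s1 !neq1 // !neq2 // eq_sym.
rewrite !big_cons big_nil /= !msymMm.
have e1 : sd * p (q (p f)) = r * (msym s U * (msym s r * f)
    + msym s V * (msym s (msym t r) * msym s (msym t (msym s f)))).
  by rewrite pE mulrCA sdE pE !msymM ssK.
have e2 : d * p (q (p f)) = U * p (q f) + V * (msym t r * msym t (msym s (q f))).
  by rewrite pqp qE; congr (_ + _); rewrite pE msymM.
have e3 : sd * p (q f) = r * (msym s U * msym s f + msym s V * msym s (msym t f)).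
  by rewrite pE mulrCA sdE.
move: (tsdE f) e1 e2 e3.
move: (p (q (p f))) (p (q f)) (msym t (msym s (q f))) => X Y Z.
move: (msym t (msym s (msym t f))) (msym s (msym t (msym s f))) => f1 f2.
move: (msym t (msym s f)) (msym s (msym t f)) => f3 f4.
move: (msym t (msym s U)) (msym t (msym s V)) (msym s (msym t r)) => u v w.
move: (msym s U) (msym s V) (msym s r) (msym t r) (msym s f) => u' v' w' x' f5.
clearbody sd tsd => e4 e1 e2 e3.
transitivity (tsd * d * (sd * X) - tsd * U * (sd * Y) - sd * V * x' * (tsd * Z)).
  by rewrite e1 e3 e4; ring.
transitivity (tsd * sd * (d * X - U * Y - V * (x' * Z))); first by ring.
by rewrite e2; ring.
Qed.

(* In K[u][v], p(v) and q(u) share no variable: q(u) is a nonzero scalar, and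
   p(v) has a unit leading coefficient, so pseudo-division by it is exact. *)
Lemma polyC_dvd_cancel (K : fieldType) (p q : {poly K}) (G H : {poly {poly K}}) :
  p != 0 -> q != 0 ->
  q%:P * G = H * map_poly polyC p -> exists G', G = G' * map_poly polyC p.
Proof.
move=> p0 q0 e; set p' := map_poly _ _ in e *.
have ul : lead_coef p' \is a GRing.unit.
  rewrite lead_coef_map_inj //; last exact: polyC_inj.
  by rewrite poly_unitE size_polyC coefC unitfE lead_coef_eq0 p0.
exists (G %/ p').
apply/esym/Pdiv.IdomainUnit.divpK => //.
by rewrite -(dvdpZr _ _ q0) -mul_polyC e Pdiv.Idomain.dvdp_mulIr.
Qed.

Lemma factor_cocycle (K : fieldType) (A B : {poly {poly K}}) (a b : {poly K}) :
  a != 0 -> b != 0 ->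
  A * b%:P * map_poly polyC a = B * a%:P * map_poly polyC b ->
  exists (C : {poly {poly K}}) (a' b' : {poly K}),
    A = a'%:P * map_poly polyC b' * C /\ B = b'%:P * map_poly polyC a' * C.
Proof.
move=> a0 b0; set g := gcdp a b.
have [a' ea] : exists a', a = a' * g by exists (a %/ g); rewrite divpK ?dvdp_gcdl.
have [b' eb] : exists b', b = b' * g by exists (b %/ g); rewrite divpK ?dvdp_gcdr.
have g0 : g != 0 by rewrite gcdp_eq0 (negPf a0).
have /Bezout_eq1_coprimepP[[u v] /= uv] : coprimep a' b'.
  have /(_ K a b) := @coprimep_div_gcd; rewrite a0 -/g => /(_ isT).
  by rewrite {1}ea {1}eb !mulpK.
have {a0} a'0 : a' != 0 by apply: contraNneq a0 => e; rewrite ea e mul0r.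
have {b0} b'0 : b' != 0 by apply: contraNneq b0 => e; rewrite eb e mul0r.
rewrite ea eb !rmorphM /=; set h := map_poly polyC => e.
have hI x : h x = 0 -> x = 0.
  by move=> hx; apply: (map_inj_poly polyC_inj (polyC0 _)); rewrite -/h hx /h map_poly0.
have {}e : b'%:P * (A * h a') = (a'%:P * B) * h b'.
  have nz : g%:P * h g != 0.
    by rewrite mulf_neq0 ?polyC_eq0 //; apply: contraNneq g0 => /hI->.
  by apply: (mulfI nz); ring: e.
have huv : h u * h a' + h v * h b' = 1 by rewrite -!rmorphM -rmorphD uv rmorph1.
have cuv : u%:P * a'%:P + v%:P * b'%:P = 1 :> {poly {poly K}}.
  by rewrite -!rmorphM -rmorphD uv.
have [A1 eA1] := polyC_dvd_cancel _ _ _ _ _ b'0 b'0 e.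
pose A2 := h u * A1 + A * h v.
have eA : A = A2 * h b'.
  by rewrite -[LHS]mulr1 -huv /A2; ring: eA1.
have ha0 : h a' != 0 by apply: contraNneq a'0 => /hI->.
have hb0 : h b' != 0 by apply: contraNneq b'0 => /hI->.
have eB : a'%:P * B = (b'%:P * A2) * h a'.
  by apply: (mulIf hb0); rewrite -e eA; ring.
have [B2 eB2] := polyC_dvd_cancel _ _ _ _ _ a'0 a'0 eB.
have eAB : b'%:P * A2 = a'%:P * B2.
  by apply: (mulIf ha0); rewrite -eB eB2; ring.
pose C := u%:P * A2 + v%:P * B2.
have eA2 : A2 = a'%:P * C by rewrite -[LHS]mul1r -cuv /C; ring: eAB.
have eB2C : B2 = b'%:P * C by rewrite -[LHS]mul1r -cuv /C; ring: eAB.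
by exists C, a', b'; rewrite eB2 eA eA2 eB2C; split; ring.
Qed.

Definition at_vars (R : comNzRingType) (n : nat) (a b : 'I_n) (A : {mpoly R[2]}) :
  {mpoly R[n]} := A \mPo [tuple 'X_a; 'X_b].

(* The first variable is the inner one. *)
Definition poly2_of_mpoly (R : comNzRingType) :
    {rmorphism {mpoly R[2]} -> {poly {poly R}}} :=
  mmap (polyC \o polyC) (fun k : 'I_2 => if k == ord0 then 'X%:P else 'X).

Lemma ord2P (P : 'I_2 -> Prop) : P ord0 -> P ord_max -> forall k, P k.
Proof.
move=> P0 P1 [[|[|//]] kP].
  by have -> : Ordinal kP = ord0 by apply: val_inj.
by have -> : Ordinal kP = ord_max by apply: val_inj.
Qed.

Section Bivariate.
Context (K : fieldType).
Local Notation u := (uvar K).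
Local Notation v := (vvar K).

Definition mpoly_of_poly2 (E : {poly {poly K}}) : {mpoly K[2]} :=
  (map_poly (horner_alg u) E).[v].

HB.instance Definition _ := GRing.RMorphism.copy mpoly_of_poly2
  (horner_eval v \o map_poly (horner_alg u)).

Lemma mpoly_of_poly2X : mpoly_of_poly2 'X = v.
Proof. by rewrite /mpoly_of_poly2 map_polyX hornerX. Qed.

Lemma mpoly_of_poly2C p : mpoly_of_poly2 p%:P = horner_alg u p.
Proof. by rewrite /mpoly_of_poly2 map_polyC hornerC. Qed.

Lemma mpoly_of_poly2_map p : mpoly_of_poly2 (map_poly polyC p) = horner_alg v p.
Proof.
rewrite /mpoly_of_poly2 -map_poly_comp /=.
by rewrite (eq_map_poly (g := in_alg _)) // => c /=; rewrite horner_algC.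
Qed.

Lemma poly2_of_mpolyC c : poly2_of_mpoly K c%:MP = c%:P%:P.
Proof. by rewrite /poly2_of_mpoly /= mmapC. Qed.

Lemma poly2_of_mpolyX k : poly2_of_mpoly K 'X_k = if k == ord0 then 'X%:P else 'X.
Proof. by rewrite /poly2_of_mpoly /= mmapX mmap1U. Qed.

Lemma poly2_of_mpolyK : cancel (poly2_of_mpoly K) mpoly_of_poly2.
Proof.
apply: (mpoly_rmorph_ext _ _ _ (mpoly_of_poly2 \o poly2_of_mpoly K) idfun) => [c|k] /=.
  by rewrite poly2_of_mpolyC mpoly_of_poly2C horner_algC -mul_mpolyC mulr1.
rewrite poly2_of_mpolyX; move: k; apply: ord2P => /=.
  by rewrite mpoly_of_poly2C horner_algX.
by rewrite mpoly_of_poly2X.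
Qed.

Lemma lead_coef_cocycle (A B : {poly {poly K}}) :
  A%:P * map_poly polyC B * map_poly (map_poly polyC) A =
    map_poly (map_poly polyC) B * map_poly polyC A * B%:P ->
  A * (lead_coef B)%:P * map_poly polyC (lead_coef A) =
    B * (lead_coef A)%:P * map_poly polyC (lead_coef B).
Proof.
have injP : injective (map_poly (polyC : K -> {poly K})).
  exact: (map_inj_poly polyC_inj (polyC0 _)).
have lc1 (D : {poly {poly K}}) :
    lead_coef (map_poly polyC D) = (lead_coef D)%:P.
  by rewrite lead_coef_map_inj //; apply: polyC_inj.
have lc2 (D : {poly {poly K}}) :
    lead_coef (map_poly (map_poly polyC) D) = map_poly polyC (lead_coef D).
  by rewrite lead_coef_map_inj // map_poly0.
move=> /(congr1 lead_coef); rewrite !lead_coefM !lead_coefC !lc1 !lc2 => ->.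
by rewrite mulrC mulrA mulrAC -mulrA mulrCA mulrA.
Qed.

Lemma cocycle_almost_equal n (x y z : 'I_n) (A B : {mpoly K[2]}) :
  x != y -> x != z -> y != z -> A != 0 -> B != 0 ->
  at_vars _ _ x y A * at_vars _ _ x z B * at_vars _ _ y z A =
  at_vars _ _ y z B * at_vars _ _ x z A * at_vars _ _ x y B ->
  almost_equal A B.
Proof.
move=> xy xz yz A0 B0.
pose h (k : 'I_n) : {poly {poly {poly K}}} :=
  if k == x then 'X%:P%:P else if k == y then 'X%:P else if k == z then 'X else 0.
pose psi : {rmorphism {mpoly K[n]} -> {poly {poly {poly K}}}} :=
  mmap (polyC \o polyC \o polyC) h.
have psiX k : psi 'X_k = h k by rewrite /psi /= mmapX mmap1U.
have psiC c : psi c%:MP = c%:P%:P%:P by rewrite /psi /= mmapC.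
have psiE a b (g : {rmorphism {poly {poly K}} -> {poly {poly {poly K}}}}) D :
    (forall c, g c%:P%:P = c%:P%:P%:P) -> g 'X%:P = h a -> g 'X = h b ->
  psi (at_vars _ _ a b D) = g (poly2_of_mpoly _ D).
  move=> gC gX gY.
  apply: (mpoly_rmorph_ext _ _ _ (psi \o comp_mpoly [tuple 'X_a; 'X_b])
    (g \o poly2_of_mpoly K)) => [c|k] /=.
    by rewrite comp_mpolyC psiC poly2_of_mpolyC gC.
  rewrite comp_mpolyXU poly2_of_mpolyX; move: k; apply: ord2P => /=.
    by rewrite psiX gX.
  by rewrite psiX gY.
have [hx [hy hz]] : h x = 'X%:P%:P /\ h y = 'X%:P /\ h z = 'X.
  by rewrite /h !eqxx !(eq_sym y) !(eq_sym z) (negPf xy) (negPf xz) (negPf yz).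
have psi_xy D : psi (at_vars _ _ x y D) = (poly2_of_mpoly _ D)%:P.
  exact: (psiE x y polyC).
have psi_xz D : psi (at_vars _ _ x z D) = map_poly polyC (poly2_of_mpoly _ D).
  apply: (psiE x z (map_poly polyC)) => [c||] /=.
  - by rewrite map_polyC.
  - by rewrite map_polyC hx.
  - by rewrite map_polyX hz.
have psi_yz D : psi (at_vars _ _ y z D) =
    map_poly (map_poly polyC) (poly2_of_mpoly _ D).
  apply: (psiE y z (map_poly (map_poly polyC))) => [c||] /=.
  - by rewrite map_polyC /= map_polyC.
  - by rewrite map_polyC /= map_polyX hy.
  - by rewrite map_polyX hz.
have psiM a b c : psi (a * b * c) = psi a * psi b * psi c by rewrite !rmorphM.
move=> /(congr1 psi); rewrite !psiM (psi_xy A) (psi_xz B) (psi_yz A).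
rewrite (psi_yz B) (psi_xz A) (psi_xy B) => /lead_coef_cocycle e.
have phi_neq0 D : D != 0 -> lead_coef (poly2_of_mpoly K D) != 0.
  rewrite lead_coef_eq0; apply: contraNneq => D0.
  by rewrite -(poly2_of_mpolyK D) D0 /mpoly_of_poly2 map_poly0 horner0.
have [C [a [b [eA eB]]]] := factor_cocycle _ _ _ _ _ (phi_neq0 _ A0) (phi_neq0 _ B0) e.
have factorE D p q : poly2_of_mpoly K D = p%:P * map_poly polyC q * C ->
    D = horner_alg u p * horner_alg v q * mpoly_of_poly2 C.
  move=> eD; rewrite -{1}(poly2_of_mpolyK D) eD !rmorphM.
  by rewrite /= mpoly_of_poly2C mpoly_of_poly2_map.
split=> //; exists (mpoly_of_poly2 C), a, b, b, a.
by split; [exact: mulrC | exact: factorE | exact: factorE].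
Qed.

End Bivariate.

Lemma msym_at_vars (R : comNzRingType) n (s : 'S_n) (a b : 'I_n) (A : {mpoly R[2]}) :
  msym s (at_vars _ _ a b A) = at_vars _ _ (s a) (s b) A.
Proof.
apply: (mpoly_rmorph_ext _ _ _ (msym s \o comp_mpoly [tuple 'X_a; 'X_b])
   (comp_mpoly [tuple 'X_(s a); 'X_(s b)])) => [c|k] /=.
  by rewrite !comp_mpolyC /msym mmapC.
by rewrite !comp_mpolyXU; move: k; apply: ord2P; rewrite /= msymX1.
Qed.

Lemma braid_reflections (R : comNzRingType) n (x y z : 'I_n) (A B : {mpoly R[2]}) :
  x != y -> x != z -> y != z ->
  at_vars _ _ x y A *
    msym (tperm x y) (at_vars _ _ y z B * msym (tperm y z) (at_vars _ _ x y A)) =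
  at_vars _ _ y z B *
    msym (tperm y z) (at_vars _ _ x y A * msym (tperm x y) (at_vars _ _ y z B)) ->
  at_vars _ _ x y A * at_vars _ _ x z B * at_vars _ _ y z A =
  at_vars _ _ y z B * at_vars _ _ x z A * at_vars _ _ x y B.
Proof.
move=> xy xz yz.
have sz : tperm x y z = z by rewrite tpermD.
have tx : tperm y z x = x by rewrite tpermD // eq_sym.
by rewrite !msymM !msym_at_vars !(tpermL, tpermR, sz, tx) !mulrA.
Qed.

Lemma at2E (K : fieldType) n (i : 'I_n.-1) (A : {mpoly K[2]}) :
  at2 i A = at_vars _ _ (vl i) (vr i) A.
Proof. by []. Qed.

Section OperatorForm.
Context (K : fieldType) (n : nat) (i : 'I_n.-1).
Implicit Types A : {mpoly K[2]}.

HB.instance Definition _ := GRing.RMorphism.copy (@at2 K n i)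
  (comp_mpoly [tuple 'X_(vl i); 'X_(vr i)]).

Lemma at2_uvar : at2 i (uvar K) = 'X_(vl i).
Proof. by rewrite /at2 comp_mpolyXU. Qed.

Lemma at2_vvar : at2 i (vvar K) = 'X_(vr i).
Proof. by rewrite /at2 comp_mpolyXU. Qed.

Let w0 : 'S_2 := tperm ord0 ord_max.

Lemma sw_at2 A : sw i (at2 i A) = at2 i (msym w0 A).
Proof.
rewrite /sw at2E msym_at_vars tpermL tpermR.
apply: (mpoly_rmorph_ext _ _ _ (comp_mpoly [tuple 'X_(vr i); 'X_(vl i)])
   (comp_mpoly [tuple 'X_(vl i); 'X_(vr i)] \o msym w0)) => [c|k] /=.
  by rewrite !comp_mpolyC /msym mmapC comp_mpolyC.
by rewrite msymX1 !comp_mpolyXU; move: k; apply: ord2P; rewrite ?tpermL ?tpermR.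
Qed.

Lemma at2_eq0 A : at2 i A = 0 -> A = 0.
Proof.
pose h (k : 'I_n) : {mpoly K[2]} := if k == vl i then uvar K else vvar K.
have atK : mmap (@mpolyC _ _) h (at2 i A) = A.
  apply: (mpoly_rmorph_ext _ _ _
    (mmap (@mpolyC _ _) h \o comp_mpoly [tuple 'X_(vl i); 'X_(vr i)]) idfun) => [c|k] /=.
    by rewrite comp_mpolyC mmapC.
  rewrite comp_mpolyXU; move: k; apply: ord2P; rewrite /= mmapX mmap1U /h ?eqxx //.
  by rewrite eq_sym (negPf (vl_neq_vr i)).
by move=> A0; rewrite -atK A0 rmorph0.
Qed.

Lemma pddoE (P Q R S : {mpoly K[2]}) f :
  ('X_(vl i) - 'X_(vr i)) * pddo P Q R S i f =
  at2 i (assoc_poly P Q R) * f +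
  at2 i ((uvar K - vvar K) * S - msym w0 P - Q) * sw i f.
Proof.
rewrite /pddo !mulrDr ddiffP (mulrCA _ (at2 i Q)) ddiffP.
rewrite /assoc_poly !(rmorphD, rmorphN, rmorphM) /= at2_uvar at2_vvar -sw_at2.
rewrite [sw i (at2 i P * f)]msymM -!/(sw i _).
ring.
Qed.

Lemma pddo_T0 (P Q R S : {mpoly K[2]}) : assoc_poly P Q R = 0 ->
  exists R', forall f, pddo P Q R S i f = at2 i R' * sw i f.
Proof.
move=> T0; have [D /eqP eD] := @ddiff_exists K 2 ord0 P.
have e0 : vl (ord0 : 'I_2.-1) = ord0 by apply: val_inj.
have e1 : vr (ord0 : 'I_2.-1) = ord_max by apply: val_inj.
rewrite /sw e0 e1 -/w0 in eD; exists (D + R + S) => f.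
apply: (mulfI (ddiff_denom_neq0 K i)); rewrite pddoE T0.
rewrite -at2_uvar -at2_vvar mulrA rmorph0 mul0r add0r -rmorphB -rmorphM /=.
congr (at2 i _ * _).
have {}eD : (uvar K - vvar K) * D = P - msym w0 P by [].
rewrite !mulrDr eD -[RHS]subr0 -T0 /assoc_poly; ring.
Qed.

End OperatorForm.

Theorem proposition12 (K : fieldType) (n : nat) (hn : (3 <= n)%N)
    (P Q R S : 'I_n.-1 -> {mpoly K[2]})
    (pi : 'I_n.-1 -> {mpoly K[n]} -> {mpoly K[n]})
    (hpi : forall i f, pi i f = pddo (P i) (Q i) (R i) (S i) i f)
    (pi_neq0 : forall i, exists f, pi i f != 0)
    (braid : forall i j : 'I_n.-1, j = i.+1 :> nat ->
       forall f, pi i (pi j (pi i f)) = pi j (pi i (pi j f)))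
    (T_eq0 : exists i, assoc_poly (P i) (Q i) (R i) = 0) :
  (forall i, assoc_poly (P i) (Q i) (R i) = 0) /\
  exists R' : 'I_n.-1 -> {mpoly K[2]},
    (forall i f, pi i f = at2 i (R' i) * sw i f) /\
    (forall i j : 'I_n.-1, j = i.+1 :> nat -> almost_equal (R' i) (R' j)).
Proof.
pose T i := assoc_poly (P i) (Q i) (R i).
pose w (i : 'I_n.-1) := tperm (vl i) (vr i).
have ww i : (w i * w i = 1)%g by rewrite tperm2.
have w_neq1 i : w i != 1%g.
  apply: contraNneq (vl_neq_vr i) => /permP/(_ (vl i)).
  by rewrite tpermL perm1 => ->.
have vrl (i j : 'I_n.-1) : j = i.+1 :> nat -> vr i = vl j.
  by move=> ij; apply: val_inj; rewrite /= ij.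
have lNr (i j : 'I_n.-1) : j = i.+1 :> nat -> vl i != vr j.
  by move=> ij; rewrite -val_eqE /= ij ltn_eqF // ltnS ltnW.
have w_neq (i j : 'I_n.-1) : j = i.+1 :> nat -> w i != w j.
  move=> ij; apply: contraNneq (vl_neq_vr i) => /permP/(_ (vl i)).
  have -> : w j (vl i) = vl i.
    by rewrite tpermD // eq_sym ?lNr // -(vrl _ _ ij) vl_neq_vr.
  by rewrite tpermL => ->.
have repr i : T i = 0 -> exists2 r, r != 0 & forall f, pi i f = at2 i r * sw i f.
  move=> T0; have [r rE] := @pddo_T0 _ _ i _ _ _ (S i) T0.
  exists r => [|f]; last by rewrite hpi.
  have [f] := pi_neq0 i; apply: contraNneq => r0.
  by rewrite hpi rE r0 rmorph0 mul0r.
have at2_neq0 i r : r != 0 -> @at2 K n i r != 0.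
  by apply: contraNneq => /at2_eq0 ->.
have step i j : w i != w j ->
    (forall f, pi i (pi j (pi i f)) = pi j (pi i (pi j f))) ->
    T i = 0 -> T j = 0.
  move=> wij brij /repr[r r0 rE]; apply: (@at2_eq0 _ _ j).
  apply: (@braid_coeff_eq0 _ _ (w i) (w j) (pi i) (pi j) _
    ('X_(vl j) - 'X_(vr j)) _ _
    (ww i) (ww j) (w_neq1 i) (w_neq1 j) wij rE _ _ _ brij).
  - by move=> f; rewrite hpi pddoE.
  - exact: at2_neq0.
  - exact: ddiff_denom_neq0.
have up (i j : 'I_n.-1) : j = i.+1 :> nat -> T i = 0 -> T j = 0.
  by move=> ij; apply: step (w_neq _ _ ij) (braid _ _ ij).
have down (i j : 'I_n.-1) : j = i.+1 :> nat -> T j = 0 -> T i = 0.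
  by move=> ij; apply: step => [|f]; [rewrite eq_sym w_neq | rewrite (braid _ _ ij)].
have T0 i : T i = 0.
  have T00 k (lk : (k < n.-1)%N) (l0 : (0 < n.-1)%N) :
      T (Ordinal lk) = 0 <-> T (Ordinal l0) = 0.
    elim: k lk => [|k IHk] lk; first by rewrite (bool_irrelevance lk l0).
    rewrite -(IHk (ltnW lk)); split; first exact: down.
    exact: up.
  have [[k lk] Tk] := T_eq0; case: i => l ll.
  have l0 : (0 < n.-1)%N by exact: leq_ltn_trans (leq0n k) lk.
  exact/(T00 l ll l0)/(T00 k lk l0).
split=> //.
have /fin_all_exists2[R' R'0 R'E] i := repr i (T0 i).
exists R'; split=> // i j ij.
have yE := vrl _ _ ij; have xz := lNr _ _ ij.
have yz : vr i != vr j by rewrite yE vl_neq_vr.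
have := braid i j ij 1; rewrite !R'E /sw !msym1 !mulr1 !at2E -yE.
move=> /(braid_reflections _ _ _ _ _ _ _ (vl_neq_vr i) xz yz).
exact: cocycle_almost_equal (vl_neq_vr i) xz yz (R'0 i) (R'0 j).
Qed.
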